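(* Consider the polynomial vector field on $\mathbb{R}^2$ $$\dot x=-x+xy,\qquad \dot y=-y.$$ The origin is a globally asymptotically stable equilibrium point, but the system does not admit a polynomial Lyapunov function (of any degree).
   Context: For a vector field $\dot z=f(z)$ on $\mathbb{R}^n$ with $f(0)=0$, a polynomial Lyapunov function (for global asymptotic stability of the origin) is a radially unbounded polynomial $V:\mathbb{R}^n\to\mathbb{R}$ with $V(0)=0$, $V(z)>0$ for all $z\ne0$, and $\dot V(z):=\langle\nabla V(z),f(z)\rangle<0$ for all $z\neq 0$. Global asymptotic stability means the origin is Lyapunov stable and every trajectory converges to it. *)

(* Defs.v *)
From HB Require Import structures.
From mathcomp Require Import all_boot all_order all_algebra.
From mathcomp Require Import all_classical all_reals all_analysis.
From mathcomp Require mpoly.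

Set Implicit Arguments.
Unset Strict Implicit.
Unset Printing Implicit Defensive.

Import Order.TTheory GRing.Theory Num.Theory.
Import numFieldNormedType.Exports.

Local Open Scope classical_set_scope.
Local Open Scope ring_scope.

(* R^n is 'rV[R]_n. Its library norm is the sup norm; radial unboundedness,
   Lyapunov stability and convergence do not depend on the choice of norm. *)

Definition trajectory (R : realType) (n : nat) (f : 'rV[R]_n -> 'rV[R]_n)
    (z : R -> 'rV[R]_n) : Prop :=
  {within `[0, +oo[, continuous z} /\
  forall t : R, 0 < t -> is_derive t (1 : R) z (f (z t)).

Definition lyapunov_stable (R : realType) (n : nat)
    (f : 'rV[R]_n -> 'rV[R]_n) : Prop :=
  forall eps : R, 0 < eps -> exists2 delta : R, 0 < delta &
    forall z : R -> 'rV[R]_n, trajectory f z -> `|z 0| < delta ->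
      forall t : R, 0 <= t -> `|z t| < eps.

(* The second clause (forward completeness) keeps the quantifications over
   trajectories on [0, +oo[ from missing initial states; for the locally
   Lipschitz fields of interest, forward solutions are unique, so that it
   excludes finite-time escape. *)
Definition globally_asymptotically_stable (R : realType) (n : nat)
    (f : 'rV[R]_n -> 'rV[R]_n) : Prop :=
  [/\ f 0 = 0,
      forall z0 : 'rV[R]_n, exists2 z, trajectory f z & z 0 = z0,
      lyapunov_stable f &
      forall z : R -> 'rV[R]_n, trajectory f z -> z t @[t --> +oo] --> (0 : 'rV[R]_n)].

Definition polynomial_function (R : realType) (n : nat)
    (V : 'rV[R]_n -> R) : Prop :=
  exists p : mpoly.mpoly n R, forall z, V z = mpoly.meval (fun i => z 0 i) p.

Definition gradient (R : realType) (n : nat) (V : 'rV[R]_n -> R)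
    (z : 'rV[R]_n) : 'rV[R]_n :=
  \row_i 'D_(delta_mx 0 i) V z.

Definition inner (R : realType) (n : nat) (u v : 'rV[R]_n) : R :=
  \sum_i u 0 i * v 0 i.

Definition radially_unbounded (R : realType) (n : nat)
    (V : 'rV[R]_n -> R) : Prop :=
  forall M : R, exists r : R, forall z, r < `|z| -> M < V z.

Definition polynomial_lyapunov_function (R : realType) (n : nat)
    (f : 'rV[R]_n -> 'rV[R]_n) (V : 'rV[R]_n -> R) : Prop :=
  [/\ polynomial_function V,
      radially_unbounded V,
      V 0 = 0,
      forall z, z != 0 -> 0 < V z &
      forall z, z != 0 -> inner (gradient V z) (f z) < 0].

Definition planar_field (R : realType) (z : 'rV[R]_2) : 'rV[R]_2 :=
  let x := z 0 0 in let y := z 0 1 in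
  \row_i [:: - x + x * y; - y]`_i.

(* Main.v *)
Require Import Defs.
From mathcomp Require Import all_boot all_order all_algebra.
From mathcomp Require Import all_classical all_reals all_analysis.
From mathcomp Require Import polyrcf ring.
From mathcomp Require mpoly.

(** Stability.  The field is triangular: y solves an autonomous linear
    equation, and once y is known x solves a linear equation with
    time-dependent coefficient y - 1.  An integrating factor therefore gives
    every trajectory in closed form ([planar_trajectoryP]):
      y(t) = y0 e^(-t),   x(t) = x0 e^(y0 (1 - e^(-t)) - t).
    Since y0 (1 - e^(-t)) <= |y0| for t >= 0, the sup norm satisfies
    |z(t)| <= |z0| e^|z0| e^(-t) ([planar_trajectory_bound]), from which both
    Lyapunov stability and convergence to the origin follow.

    No polynomial Lyapunov function.  Write a polynomial V as
      V(x, y) = a_n(y) x^n + ... + a_0(y)   with a_n != 0.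
    Its derivative along the field, x (y - 1) V_x - y V_y, is again a
    polynomial, of degree at most n in x, and its coefficient of x^n is
      n (y - 1) a_n(y) - y a_n'(y).
    If n >= 1 the term n y a_n(y) dominates here for large y, so the leading
    coefficient in y of this leading coefficient in x is n times that of V
    ([lead_coef_lie_derivative]).  A bivariate polynomial has the sign of
    this iterated leading coefficient at some points with x > 0, namely for y
    large and then x large depending on y ([bivariate_lead_pos]).  Positivity
    of V thus forces a positive iterated leading coefficient, and the
    derivative of V along the field is positive somewhere.  If n = 0, that
    derivative vanishes on the axis y = 0.  Both contradict the strict
    decrease of V.

    Polynomials in (x, y) are handled as elements P of {poly {poly R}}, with
    x the outer variable and y the inner one, so that P(x, y) is
    P.[x%:P].[y]. *)

Import Order.TTheory GRing.Theory Num.Theory.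
Import numFieldNormedType.Exports.

Local Open Scope classical_set_scope.
Local Open Scope ring_scope.

(** * Iterated leading coefficients of bivariate polynomials *)

(** The order of the choices matters: y is taken large enough for the
    coefficient of the top power of x to be positive at y, and only then does
    that power of x dominate the others. *)
Lemma bivariate_lead_pos {R : rcfType} (Q : {poly {poly R}}) :
  0 < lead_coef (lead_coef Q) ->
  exists Y, forall y, Y <= y ->
    exists X, forall x, X <= x -> 0 < Q.[x%:P].[y].
Proof.
move=> /[dup] c0 /poly_pinfty_gt_lc [Y hY]; exists Y => y /hY hy.
have ly0 : 0 < (lead_coef Q).[y] by apply: lt_le_trans hy.
have lE : lead_coef (map_poly (horner_eval y) Q) = (lead_coef Q).[y].
  by rewrite lead_coef_map_eq //= /horner_eval gt_eqF.
move: (ly0); rewrite -lE => /[dup] l0 /poly_pinfty_gt_lc [X hX].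
exists X => x /hX hx.
rewrite (_ : Q.[x%:P].[y] = (map_poly (horner_eval y) Q).[x]).
  exact: lt_le_trans hx.
by rewrite -[in RHS](hornerC x y) (horner_map (horner_eval y) Q x%:P).
Qed.

(** The polynomial x (y - 1) P_x - y P_y, that is, the derivative of P along
    the field (-x + x y, -y), given by its coefficients in x. *)
Definition lie_derivative {R : nzRingType} (P : {poly {poly R}}) :
    {poly {poly R}} :=
  \poly_(i < size P) (('X - 1) * P`_i *+ i - 'X * (P`_i)^`()).

Lemma lie_derivativeE {R : comNzRingType} (P : {poly {poly R}}) (x y : R) :
  (lie_derivative P).[x%:P].[y] =
    P^`().[x%:P].[y] * (- x + x * y) - (P.[x%:P])^`().[y] * y.
Proof.
have -> : (lie_derivative P).[x%:P] =
    ('X - 1) * (x%:P * P^`().[x%:P]) - 'X * (P.[x%:P])^`().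
  have -> : x%:P * P^`().[x%:P] = (\poly_(i < size P) (P`_i *+ i)).[x%:P].
    rewrite mulrC -hornerMX; congr (_.[_]); apply/polyP => i.
    rewrite coefMX coef_deriv coef_poly; case: i => [|i] /=.
      by rewrite mulr0n if_same.
    by case: ltnP => // h; rewrite nth_default ?mul0rn.
  rewrite /lie_derivative !horner_poly (horner_coef P) raddf_sum /=.
  rewrite !mulr_sumr -sumrB; apply: eq_bigr => i _.
  by rewrite -polyC_exp derivM derivC mulr0 addr0 mulrBl !mulrA mulrnAr.
by rewrite !(hornerD, hornerN, hornerM, hornerX, hornerC); ring.
Qed.

(** With a the leading coefficient in x, the coefficient of x^n in the
    derivative is c = n (y - 1) a - y a'.  Both y a' and n a have degree
    at most that of a, so the top term of c comes from n y a alone;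
    it is nonzero because n >= 1 and the characteristic is 0. *)
Lemma lead_coef_lie_derivative {R : numDomainType} (P : {poly {poly R}}) :
  (1 < size P)%N ->
  lead_coef (lead_coef (lie_derivative P)) =
    lead_coef (lead_coef P) *+ (size P).-1.
Proof.
case sP: (size P) => [|[|m]] //= _; set n := m.+1.
have sP1 : (size P).-1 = n by rewrite sP.
set a := lead_coef P.
have a0 : a != 0 by rewrite lead_coef_eq0 -size_poly_eq0 sP.
set c := ('X - 1) * a *+ n - 'X * a^`().
have cS i : c`_i.+1 = a`_i *+ n - a`_i.+1 *+ n - a`_i.+1 *+ i.+1.
  by rewrite /c mulrBl mul1r coefB coefMn coefB !coefXM /= coef_deriv mulrnBl.
have sa : size a = (size a).-1.+1 by rewrite prednK // size_poly_gt0.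
have ctop : c`_(size a) = lead_coef a *+ n.
  rewrite sa cS -sa (nth_default _ (leqnn (size a))).
  by rewrite !mul0rn !subr0 lead_coefE.
have ltop0 : lead_coef a *+ n != 0.
  by rewrite mulrn_eq0 negb_or /= lead_coef_eq0.
have sc : size c = (size a).+1.
  apply/eqP; rewrite eqn_leq; apply/andP; split.
    apply/leq_sizeP => -[//|j] h; rewrite cS.
    by rewrite !(nth_default 0) ?mul0rn ?subr0 // leqW.
  by rewrite ltnNge; apply: contra ltop0 => h; rewrite -ctop nth_default.
have c0 : c != 0 by rewrite -size_poly_eq0 sc.
have cE : lead_coef (lie_derivative P) = c.
  rewrite /lie_derivative sP lead_coef_poly //.
    by rewrite /c /a lead_coefE sP1.
  by move: c0; rewrite /c /a lead_coefE sP1.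
by rewrite cE lead_coefE sc.
Qed.

(** * Nonexistence of a polynomial Lyapunov function *)

Definition plane_point {R : nmodType} (x y : R) : 'rV[R]_2 :=
  \row_i [:: x; y]`_i.

Lemma polynomial_function_bivariate {R : realType} (V : 'rV[R]_2 -> R) :
  polynomial_function V ->
  exists P : {poly {poly R}}, forall z, V z = P.[(z 0 0)%:P].[z 0 1].
Proof.
move=> [p Vp].
exists (mpoly.mmap (polyC \o polyC) (fun i => if i == 0 then 'X else 'X%:P) p).
move=> z; rewrite Vp mpoly.mevalE /mpoly.mmap !horner_sum.
apply: eq_bigr => m _; rewrite /mpoly.mmap1 !big_ord_recl !big_ord0 !mulr1 /=.
have -> : lift ord0 ord0 = 1 :> 'I_2 by exact/val_inj.
by rewrite !(hornerM, horner_exp, hornerC, hornerX).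
Qed.

(** A partial derivative only sees V on a line parallel to the axis, where V
    is the univariate polynomial q; the two difference quotients coincide. *)
Lemma derive_along_coordinate {R : realType} {n : nat} (V : 'rV[R]_n -> R)
    (z : 'rV[R]_n) (i : 'I_n) (q : {poly R}) :
  (forall h, V (h *: delta_mx 0 i + z) = q.[h + z 0 i]) ->
  'D_(delta_mx 0 i) V z = q^`().[z 0 i].
Proof.
move=> Vq; transitivity ('D_1 (horner q) (z 0 i)); last exact: derive_val.
rewrite /derive /=; set F := (X in _ = lim (X @ _)).
rewrite (_ : (fun h => _) = F) //; apply/funext => h; rewrite /F.
have -> : V z = q.[z 0 i].
  by rewrite -[in LHS](add0r z) -[0](scale0r (delta_mx 0 i)) Vq add0r.
by rewrite Vq [h *: 1]mulr1.
Qed.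

Lemma inner_gradient_planar_field {R : realType} (V : 'rV[R]_2 -> R)
    (P : {poly {poly R}}) (z : 'rV[R]_2) :
  (forall z, V z = P.[(z 0 0)%:P].[z 0 1]) ->
  inner (gradient V z) (planar_field z) =
    (lie_derivative P).[(z 0 0)%:P].[z 0 1].
Proof.
move=> VP.
have i1 : lift ord0 ord0 = 1 :> 'I_2 by exact/val_inj.
have Vx : gradient V z 0 0 = P^`().[(z 0 0)%:P].[z 0 1].
  pose q := map_poly (horner_eval (z 0 1)) P.
  rewrite mxE (derive_along_coordinate _ _ _ q).
    rewrite -[z 0 0 in LHS](hornerC _ (z 0 1)) deriv_map.
    by rewrite (horner_map (horner_eval (z 0 1)) _ (z 0 0)%:P).
  move=> h; rewrite VP !mxE /= mulr1 mulr0 add0r.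
  rewrite -[_ + _ in RHS](hornerC _ (z 0 1)).
  by rewrite (horner_map (horner_eval (z 0 1)) _ (_)%:P).
have Vy : gradient V z 0 1 = (P.[(z 0 0)%:P])^`().[z 0 1].
  rewrite mxE (derive_along_coordinate _ _ _ (P.[(z 0 0)%:P])) //.
  by move=> h; rewrite VP !mxE /= mulr1 mulr0 add0r.
rewrite lie_derivativeE /inner !big_ord_recl big_ord0 addr0 i1 Vx Vy.
by rewrite !mxE /= mulrN.
Qed.

Lemma no_polynomial_lyapunov {R : realType} (V : 'rV[R]_2 -> R) :
  ~ polynomial_lyapunov_function (@planar_field R) V.
Proof.
move=> [/polynomial_function_bivariate [P VP] _ _ Vpos Vneg].
have ptE x y : V (plane_point x y) = P.[x%:P].[y] by rewrite VP !mxE.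
have dptE x y :
    inner (gradient V (plane_point x y)) (planar_field (plane_point x y))
    = (lie_derivative P).[x%:P].[y].
  by rewrite (inner_gradient_planar_field _ P) // !mxE.
have pt0 x y : 0 < x -> plane_point x y != 0.
  by apply: contraTneq => /rowP/(_ 0); rewrite !mxE /= => ->; rewrite ltxx.
have Ppos x y : 0 < x -> 0 < P.[x%:P].[y].
  by move=> /pt0 h; rewrite -ptE Vpos.
have Dneg x y : 0 < x -> (lie_derivative P).[x%:P].[y] < 0.
  by move=> /pt0 h; rewrite -dptE Vneg.
(* If V did not depend on x, its derivative would vanish at (1, 0). *)
have sP : (1 < size P)%N.
  rewrite ltnNge; apply/negP => /size1_polyC PC.
  have := Dneg 1 0 ltr01.
  by rewrite lie_derivativeE PC derivC !horner0 mul0r mulr0 subr0 ltxx.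
have lP : 0 < lead_coef (lead_coef P).
  rewrite lt_neqAle eq_sym !lead_coef_eq0 -size_poly_eq0 -lt0n (ltnW sP) /=.
  rewrite leNgt -oppr_gt0 -!lead_coefN; apply/negP => /bivariate_lead_pos.
  move=> [Y /(_ Y (lexx _)) [X /(_ (Num.max X 1))]].
  rewrite le_max lexx => /(_ isT); rewrite !hornerN oppr_gt0 ltNge ltW //.
  by rewrite Ppos // lt_max ltr01 orbT.
have : 0 < lead_coef (lead_coef (lie_derivative P)).
  by rewrite lead_coef_lie_derivative // pmulrn_lgt0 // -subn1 subn_gt0.
move=> /bivariate_lead_pos [Y /(_ Y (lexx _)) [X /(_ (Num.max X 1))]].
rewrite le_max lexx => /(_ isT); rewrite ltNge ltW //.
by rewrite Dneg // lt_max ltr01 orbT.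
Qed.

(** * Calculus of vector-valued curves, coordinate by coordinate *)

Lemma within_continuous_coord {R : realType} {n : nat} (A : set R)
    (z : R -> 'rV[R]_n) i :
  {within A, continuous z} -> {within A, continuous (fun t => z t 0 i)}.
Proof.
move=> cz t.
apply: (@continuous_comp (subspace A) _ _ z (fun v => v 0 i) t (cz t)).
exact: coord_continuous.
Qed.

Lemma is_derive_row {R : realType} {n : nat} (z : R -> 'rV[R]_n) (t : R)
    (dz : 'rV[R]_n) :
  is_derive t 1 z dz <-> forall i, is_derive t 1 (fun s => z s 0 i) (dz 0 i).
Proof.
split=> [zdz i|zdz].
  have [dv <-] := zdz.
  split; first by have /derivable_mxP := dv; exact.
  by rewrite derive_mx // mxE.
have dv : derivable z t 1.
  by apply/derivable_mxP => i j; rewrite ord1; case: (zdz j).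
split => //; apply/rowP => i; rewrite derive_mx // mxE.
by case: (zdz i).
Qed.

Lemma row_norm_le {R : realType} {n : nat} (v : 'rV[R]_n) (M : R) :
  0 <= M -> (forall i, `|v 0 i| <= M) -> `|v| <= M.
Proof.
move=> M0 vM; rewrite [leLHS]/Num.Def.normr /= mx_normrE.
by apply: bigmax_le => // -[i j] _ /=; rewrite ord1.
Qed.

Lemma coord_le_row_norm {R : realType} {n : nat} (v : 'rV[R]_n) i :
  `|v 0 i| <= `|v|.
Proof.
rewrite [leRHS]/Num.Def.normr /= mx_normrE.
exact: (le_bigmax _ (fun j : 'I_1 * 'I_n => `|v j.1 j.2|) (0, i)).
Qed.

(** * Closed form of the trajectories *)

(** Integrating factor: u e^(-A) has zero derivative on the open half line and
    is continuous up to 0, hence is constant. *)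
Lemma linear_ode_unique {R : realType} (u a A : R -> R) :
  {within `[0, +oo[, continuous u} ->
  (forall t : R, 0 < t -> is_derive t 1 u (a t * u t)) ->
  (forall t : R, is_derive t 1 A (a t)) ->
  forall t : R, 0 <= t -> u t = u 0 * expR (A t - A 0).
Proof.
move=> cu du dA t t0.
pose g s := u s * expR (- A s).
have dg s : s \in `]0, t[ -> is_derive s 1 g 0.
  rewrite in_itv /= => /andP[s0 _]; have us := du s s0; have As := dA s.
  apply: is_derive_eq.
  rewrite /GRing.scale /=; ring.
have cg : {within `[0, t], continuous g}.
  move=> s.
  apply: (@continuousM _ (subspace `[0, t]) u (fun s => expR (- A s)) s).
    move: s; apply: continuous_subspaceW cu => s /=.
    by rewrite !in_itv /= andbT => /andP[].
  move: s; apply: continuous_subspaceT => s.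
  apply: differentiable_continuous; apply/derivable1_diffP.
  have As := dA s; exact: ex_derive.
have [c _] := MVT_segment t0 dg cg.
rewrite mul0r => /eqP; rewrite subr_eq0 => /eqP gE.
rewrite expRD mulrCA -/(g 0) -gE /g mulrCA.
by rewrite -expRD subrr expR0 mulr1.
Qed.

Definition planar_flow {R : realType} (z0 : 'rV[R]_2) (t : R) : 'rV[R]_2 :=
  plane_point (z0 0 0 * expR (z0 0 1 * (1 - expR (- t)) - t))
              (z0 0 1 * expR (- t)).

(** The coordinate y is solved first; the equation of x is then linear with
    coefficient -1 + y0 e^(-t), whose primitive is -t - y0 e^(-t). *)
Lemma planar_trajectoryP {R : realType} (z : R -> 'rV[R]_2) :
  trajectory (@planar_field R) z ->
  forall t, 0 <= t -> z t = planar_flow (z 0) t.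
Proof.
move=> [cz dz].
have yE (t : R) : 0 <= t -> z t 0 1 = z 0 0 1 * expR (- t).
  have cy := within_continuous_coord _ z 1 cz.
  have dy (s : R) : 0 < s -> is_derive s 1 (fun s => z s 0 1) (-1 * z s 0 1).
    by move=> s0; have /is_derive_row /(_ 1) := dz s s0; rewrite mxE /= mulN1r.
  have dA (s : R) : is_derive s 1 (fun s => - s) (-1) by exact: is_deriveNid.
  by move=> t0; rewrite (linear_ode_unique _ _ _ cy dy dA t t0) oppr0 subr0.
have cx := within_continuous_coord _ z 0 cz.
have dx (s : R) : 0 < s ->
    is_derive s 1 (fun s => z s 0 0) ((-1 + z 0 0 1 * expR (- s)) * z s 0 0).
  move=> s0; have /is_derive_row /(_ 0) := dz s s0.
  by rewrite mxE /= yE ?ltW // mulrDl mulN1r [z s 0 0 * _]mulrC.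
have dA (s : R) : is_derive s 1 (fun s => - s - z 0 0 1 * expR (- s))
    (-1 + z 0 0 1 * expR (- s)).
  apply: is_derive_eq; rewrite /GRing.scale /=; ring.
move=> t t0; apply/rowP => i; rewrite mxE.
have [->|->] : i = 0 \/ i = 1.
  by case: i => -[|[|//]] ?; [left|right]; exact/val_inj.
  rewrite /= (linear_ode_unique _ _ _ cx dx dA t t0).
  by congr (_ * expR _); rewrite oppr0 expR0; ring.
exact: yE.
Qed.

Lemma planar_trajectory_exists {R : realType} (z0 : 'rV[R]_2) :
  exists2 z, trajectory (@planar_field R) z & z 0 = z0.
Proof.
exists (planar_flow z0); last first.
  apply/rowP => i.
  rewrite mxE oppr0 expR0 subrr mulr0 addr0 expR0 !mulr1.
  by case: i => -[|[|//]] ? /=; apply: (congr1 (z0 0)); exact/val_inj.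
have dz (t : R) :
    is_derive t 1 (planar_flow z0) (planar_field (planar_flow z0 t)).
  apply/is_derive_row => i.
  under eq_fun do rewrite mxE; rewrite !mxE /=.
  case: i => -[|[|//]] ? /=; apply: is_derive_eq; rewrite /GRing.scale /=; ring.
split; last by move=> t _; exact: dz.
apply: continuous_subspaceT => t.
by apply: differentiable_continuous; apply/derivable1_diffP; have [] := dz t.
Qed.

(** * Global asymptotic stability *)

Lemma planar_trajectory_bound {R : realType} (z : R -> 'rV[R]_2) :
  trajectory (@planar_field R) z -> forall t, 0 <= t ->
    `|z t| <= `|z 0| * expR `|z 0| * expR (- t).
Proof.
move=> /planar_trajectoryP zE t t0; rewrite [in leLHS]zE //.
have e0 (x : R) := expR_ge0 x.
apply: row_norm_le => [|i]; first by rewrite !mulr_ge0.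
rewrite mxE; case: i => -[|[|//]] ? /=; rewrite normrM (ger0_norm (e0 _)).
  rewrite -mulrA -expRD ler_pM // ?coord_le_row_norm // ler_expR lerD2r.
  apply: (le_trans (ler_norm _)); rewrite normrM -[leRHS]mulr1.
  rewrite ler_pM // ?coord_le_row_norm // ger0_norm ?gerBl //.
  by rewrite subr_ge0 expR_le1 oppr_le0.
rewrite ler_pM2r ?expR_gt0 // -[leLHS]mulr1 ler_pM // ?coord_le_row_norm //.
by rewrite -expR0 ler_expR.
Qed.

Lemma planar_field_gas {R : realType} :
  globally_asymptotically_stable (@planar_field R).
Proof.
split.
- apply/rowP => i; rewrite !mxE /=.
  by case: i => -[|[|//]] ? /=; rewrite ?mul0r oppr0 ?addr0.
- exact: planar_trajectory_exists.
(* Starting in the unit ball, |z0| e^|z0| is at most e |z0|. *)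
- move=> eps e0; exists (Num.min 1 (eps / expR 1)).
    by rewrite lt_min ltr01 divr_gt0 // expR_gt0.
  move=> z /planar_trajectory_bound zb; rewrite lt_min => /andP[z1 ze] t t0.
  apply: le_lt_trans (zb t t0) _; rewrite ltr_pdivlMr ?expR_gt0 // in ze.
  apply: le_lt_trans ze; rewrite -mulrA ler_wpM2l //.
  rewrite -[leRHS]mulr1 ler_pM ?expR_ge0 // ?ler_expR ?(ltW z1) //.
  by rewrite expR_le1 oppr_le0.
- move=> z /planar_trajectory_bound zb.
  apply/norm_cvg0P.
  apply: (@squeeze_cvgr _ _ _ _ (fun=> 0)
    (fun t => `|z 0| * expR `|z 0| * expR (- t))).
  + near=> t; rewrite normr_ge0 /= zb //.
  + exact: cvg_cst.
  + rewrite -[X in _ --> X](mulr0 (`|z 0| * expR `|z 0|)).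
    by apply: cvgMr; exact: cvgr_expR.
Unshelve. all: by end_near. Qed.

Theorem theorem4p5 (R : realType) :
  globally_asymptotically_stable (@planar_field R) /\
  ~ (exists V : 'rV[R]_2 -> R, polynomial_lyapunov_function (@planar_field R) V).
Proof.
split; first exact: planar_field_gas.
by move=> [V]; exact: no_polynomial_lyapunov.
Qed.
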